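(* Let $G$ be a graph, $x\in V(G)$, and $N_G(x)=Y\cup Z$ any partition into two disjoint (possibly empty) sets. Then for every field $\Bbbk$, $\operatorname{reg}_{\Bbbk}(\mathcal{L}_x(G;Y,Z))=\operatorname{reg}_{\Bbbk}(G)+1$.
   Context: All graphs are finite and simple; $\operatorname{reg}_{\Bbbk}(G)=\max\{j\ge 0:\widetilde H_{j-1}(\operatorname{Ind}(G[S]);\Bbbk)\neq 0\text{ for some }S\subseteq V(G)\}$, where $\operatorname{Ind}$ denotes the independence complex and $\operatorname{Ind}$ of the empty graph is $\{\emptyset\}$ with $\widetilde H_{-1}=\Bbbk$. The Lozin transform $\mathcal{L}_x(G;Y,Z)$: delete $x$ and its incident edges, add four new vertices $y,a,b,z$ forming the path with edges $ya,ab,bz$, and join $y$ to every vertex of $Y$ and $z$ to every vertex of $Z$. (If $x$ is isolated, the result is $(G-x)$ plus a disjoint path on 4 vertices.) *)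

(* Defs.v *)
From HB Require Import structures.
From mathcomp Require Import all_boot all_order all_algebra.
Set Implicit Arguments. Unset Strict Implicit. Unset Printing Implicit Defensive.
Import GRing.Theory.
Local Open Scope ring_scope.

(* A finite simple graph is a symmetric irreflexive relation [e] on a finType
   [T] (the vertex set is all of [T]). *)

Section IndComplex.
Variables (K : fieldType) (T : finType) (e : rel T).

Definition independent (A : {set T}) : bool :=
  [forall u in A, forall v in A, ~~ e u v].

(* Faces of Ind(G[S]) having exactly [k] vertices (dimension k-1). *)
Definition faces (S : {set T}) (k : nat) : {set {set T}} :=
  [set A : {set T} | (A \subset S) && independent A && (#|A| == k)].

(* Simplicial boundary coefficient [A : B] for #|A| = #|B| + 1, using the
   total order on T given by [enum_rank]: (-1)^(position of v in A) if
   B = A \ {v}, and 0 if B is not a facet of A. *)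
Definition bdcoef (A B : {set T}) : K :=
  \sum_(v in A | B == A :\ v)
     (-1) ^+ #|[set u in A | (enum_rank u < enum_rank v)%N]|.

(* Boundary map C_{k} -> C_{k-1} of the augmented chain complex of
   Ind(G[S]) over K, from chains on faces with k+1 vertices to chains on
   faces with k vertices; chains are row vectors (c |-> c *m bdmx). *)
Definition bdmx (S : {set T}) (k : nat) :
  'M[K]_(#|faces S k.+1|, #|faces S k|) :=
  \matrix_(i, j) bdcoef (enum_val i) (enum_val j).

(* Row space of cycles on faces with [k] vertices (for k = 0, the empty
   face, the augmented boundary into degree -2 is zero: everything is a
   cycle). *)
Definition cycles (S : {set T}) (k : nat) : 'M[K]_(#|faces S k|) :=
  match k as n return 'M[K]_(#|faces S n|) with
  | 0 => 1%:M
  | k'.+1 => kermx (bdmx S k')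
  end.

(* \tilde H_{k-1}(Ind(G[S]); K) <> 0 : not every cycle is a boundary. *)
Definition redhom_nz (S : {set T}) (k : nat) : bool :=
  ~~ (cycles S k <= bdmx S k)%MS.

(* reg_K(G) = max { j : \tilde H_{j-1}(Ind(G[S]);K) <> 0 for some S }.
   For j > #|T| there are no faces, so the max may be taken over j <= #|T|+1. *)
Definition reg : nat :=
  \max_(j < #|T|.+2 | [exists S : {set T}, redhom_nz S j]) j.

End IndComplex.

(* The Lozin transform L_x(G;Y,Z).  Vertex type: the vertices of G other
   than x, plus four new vertices y = 0, a = 1, b = 2, z = 3. *)
Definition lozin_vtx (T : finType) (x : T) : finType :=
  ({v : T | v != x} + 'I_4)%type.

Definition lozin_rel (T : finType) (e : rel T) (x : T) (Y Z : {set T})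
  : rel (lozin_vtx x) :=
  fun p q =>
    match p, q with
    | inl u, inl v => e (val u) (val v)
    | inl u, inr i => ((val i == 0%N) && (val u \in Y)) || ((val i == 3%N) && (val u \in Z))
    | inr i, inl u => ((val i == 0%N) && (val u \in Y)) || ((val i == 3%N) && (val u \in Z))
    | inr i, inr j => (val i == (val j).+1) || (val j == (val i).+1)
    end.

Arguments lozin_rel {T} e x Y Z.
Arguments reg K {T} e.

(* Main.v *)
Require Import Defs.
From Corelib Require Import Setoid.
From HB Require Import structures.
From mathcomp Require Import all_boot all_order all_algebra.
Set Implicit Arguments. Unset Strict Implicit. Unset Printing Implicit Defensive.
Import GRing.Theory.
Local Open Scope ring_scope.

(** The independence complex satisfies two exactness principles at a vertex [v]
    of [S]: if the link of [v] (which is [Ind] of [S] minus the closed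
    neighbourhood) is acyclic then [v] can be deleted, and if [S - v] is acyclic
    then [Ind (G[S])] has the homology of the suspension of that link.  In
    particular [v] can be deleted as soon as some non-adjacent [u] satisfies
    [N(u)] contained in [N(v)].

    For the Lozin transform put [x] back, joined to its old neighbours and to
    [a].  It dominates [y], so adding it changes nothing; now [y] can be deleted,
    because in its link [x] dominates [z] and then [b] is isolated; finally
    without [b] the vertex [z] makes [x] deletable and isolates [a], so the
    homology is the suspension of that of the link of [b], which is [G[S]].  An
    induced subgraph of the transform missing one of [y, a, b, z] has a leaf or
    an isolated vertex (or misses both [a] and [b]); deleting vertices reduces
    it, with a shift by at most one, to subgraphs in which [y] alone, or [z]
    alone, is a twin of [x]. *)

(** * Signs given by positions in the vertex order *)

Section Sign.
Variables (K : fieldType) (T : finType).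
Implicit Types (u v w : T) (A B : {set T}).

Definition psgn u v : K := if (enum_rank u < enum_rank v)%N then -1 else 1.
(** Since [psgn v v] is 1, the value is the same at [A] and at [v |: A], so one formula serves both
    for adding and for removing [v]. *)
Definition sgn v A : K := \prod_(u in A) psgn u v.

Lemma enum_rank_ltgt u v : u != v ->
  (enum_rank v < enum_rank u)%N = ~~ (enum_rank u < enum_rank v)%N.
Proof.
move=> uv; have: enum_rank u != enum_rank v by rewrite (inj_eq enum_rank_inj).
by rewrite -val_eqE /=; case: ltngtP.
Qed.

Lemma psgnxx v : psgn v v = 1.
Proof. by rewrite /psgn ltnn. Qed.

Lemma psgn_sqr u v : psgn u v * psgn u v = 1.
Proof. by rewrite /psgn; case: ifP => _; rewrite ?mulrNN mul1r. Qed.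

Lemma psgn_anti u v : u != v -> psgn v u = - psgn u v.
Proof.
by move=> uv; rewrite /psgn enum_rank_ltgt //; case: ltnP; rewrite ?opprK.
Qed.

Lemma sgn_sqr v A : sgn v A * sgn v A = 1.
Proof. by rewrite /sgn -big_split big1 //= => u _; exact: psgn_sqr. Qed.

Lemma sgnU1 v w A : w \notin A -> sgn v (w |: A) = psgn w v * sgn v A.
Proof. by move=> wA; rewrite /sgn big_setU1. Qed.

Lemma sgnE v A : sgn v A = (-1) ^+ #|[set u in A | (enum_rank u < enum_rank v)%N]|.
Proof.
by rewrite /sgn /psgn -big_mkcondr -prodr_const; apply: eq_bigl => u; rewrite inE.
Qed.

End Sign.

(** * Homology of independence complexes *)

Section Chains.
Variables (K : fieldType) (T : finType).
Implicit Types (u v w : T) (A B S : {set T}).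

Local Notation cvec := {ffun {set T} -> K}.
Implicit Types (c d : cvec).

(** Chains are functions on all subsets of [T] and [bd] is the boundary of the full simplex; support
    in a subcomplex is the separate predicate [chain], which avoids dependent types. *)
Definition bd c : cvec :=
  [ffun B : {set T} => \sum_(v | v \notin B) sgn K v B * c (v |: B)].

(** Exterior multiplication by [v]; its companion [contr] is the interior product. *)
Definition wedge v c : cvec :=
  [ffun A : {set T} => if v \in A then sgn K v A * c (A :\ v) else 0].

Definition contr v c : cvec :=
  [ffun A : {set T} => if v \in A then 0 else sgn K v A * c (v |: A)].

Lemma bd_is_zmod_morphism : zmod_morphism bd.
Proof.
move=> c d; apply/ffunP => B; rewrite !ffunE -sumrB; apply: eq_bigr => v _.
by rewrite !ffunE mulrBr.
Qed.
HB.instance Definition _ :=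
  GRing.isZmodMorphism.Build cvec cvec bd bd_is_zmod_morphism.

Lemma wedge_is_zmod_morphism v : zmod_morphism (wedge v).
Proof.
move=> c d; apply/ffunP => A; rewrite !ffunE; case: ifP => _; last by rewrite subr0.
by rewrite mulrBr.
Qed.
HB.instance Definition _ v :=
  GRing.isZmodMorphism.Build cvec cvec (wedge v) (wedge_is_zmod_morphism v).

(** The cone homotopy formula. Terms involving a second vertex [w] cancel because exchanging [v] and
    [w] flips the sign. *)
Lemma bd_wedge v c : bd (wedge v c) = c - wedge v (bd c).
Proof.
apply/ffunP => B; rewrite !ffunE.
have [vB|vB] := boolP (v \in B); last first.
  rewrite subr0 (bigD1 v) //= !ffunE setU11 setU1K // big1 ?addr0.
    by rewrite sgnU1 // psgnxx mul1r mulrA sgn_sqr mul1r.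
  by move=> w /andP[wB wv]; rewrite !ffunE !inE eq_sym (negbTE wv) (negbTE vB) mulr0.
(* The summand of [v] cancels [c B]; the remaining ones are compared termwise. *)
rewrite [in RHS](bigD1 v) ?inE ?eqxx //= setD1K // mulrDr mulrA opprD addrA.
have -> : sgn K v B * sgn K v (B :\ v) = 1.
  by rewrite -{1}(setD1K vB) sgnU1 ?inE ?eqxx // psgnxx mul1r sgn_sqr.
rewrite mul1r subrr add0r mulr_sumr -sumrN.
apply: eq_big => [w|w wB].
  by rewrite !inE; case: eqVneq => [->|_]; rewrite ?vB ?andbT.
have wv : w != v by apply: contraNneq wB => ->.
rewrite !ffunE inE vB orbT.
have -> : (w |: B) :\ v = w |: (B :\ v).
  by apply/setP => u; rewrite !inE; case: (eqVneq u w) => // ->; rewrite wv.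
rewrite !mulrA -mulNr; congr (_ * _).
rewrite sgnU1 // (psgn_anti _ (u := v)) 1?eq_sym //.
rewrite -{1}(setD1K vB) sgnU1 ?inE ?eqxx //.
rewrite mulNr mulrN; congr (- _).
by rewrite mulrACA psgn_sqr mul1r mulrC.
Qed.

Lemma bd_contr v c : bd (contr v c) = - contr v (bd c).
Proof.
apply/ffunP => B; rewrite !ffunE.
have [vB|vB] := boolP (v \in B).
  by rewrite oppr0 big1 // => w wB; rewrite !ffunE inE vB orbT mulr0.
rewrite (bigD1 v) //= !ffunE setU11 mulr0 add0r mulr_sumr -sumrN.
apply: eq_big => [w|w /andP[wB wv]].
  by rewrite !inE negb_or andbC.
rewrite !ffunE !inE eq_sym (negbTE wv) (negbTE vB) /= setUCA -mulNr !mulrA.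
congr (_ * _); rewrite !sgnU1 // (psgn_anti _ wv) !mulNr mulrN opprK.
by rewrite mulrC -mulrA mulrCA.
Qed.

(** This composite is the projection onto the faces through [v]; subtracting it from a chain leaves
    the part supported off [v]. *)
Lemma wedge_contr v c A : wedge v (contr v c) A = if v \in A then c A else 0.
Proof.
rewrite !ffunE; case: ifP => // vA.
rewrite !inE eqxx /= setD1K // mulrA.
by rewrite -{1}(setD1K vA) sgnU1 ?inE ?eqxx // psgnxx mul1r sgn_sqr mul1r.
Qed.

Variables (e : rel T).

Definition chain S k c := forall A, A \notin faces e S k -> c A = 0.

(** The index counts vertices, so [k] stands for reduced homology in degree [k - 1]. For [k = 0]
    every chain has zero boundary. *)
Definition acyclic_at S k :=
  forall c, chain S k c -> bd c = 0 -> exists2 d, chain S k.+1 d & bd d = c.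

Lemma facesP S k A : reflect
  [/\ {subset A <= S}, {in A &, forall u v, ~~ e u v} & #|A| = k]
  (A \in faces e S k).
Proof.
rewrite inE; apply: (iffP andP) => [[/andP[/subsetP sAS iA] /eqP cA]|[sAS iA ->]].
  split=> // u v uA vA.
  by move: iA => /'forall_implyP/(_ u uA)/'forall_implyP/(_ v vA).
rewrite eqxx; split=> //; apply/andP; split; first exact/subsetP.
apply/'forall_implyP => u uA; apply/'forall_implyP => v vA; exact: iA.
Qed.

Lemma chainD S k c d : chain S k c -> chain S k d -> chain S k (c + d).
Proof. by move=> hc hd A hA; rewrite !ffunE hc // hd // addr0. Qed.

Lemma chainN S k c : chain S k c -> chain S k (- c).
Proof. by move=> hc A hA; rewrite !ffunE hc // oppr0. Qed.

Lemma chain_sub S S' k c : S \subset S' -> chain S k c -> chain S' k c.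
Proof.
move=> /subsetP sS hc A hA; apply: hc; apply: contraNN hA => /facesP[sA iA cA].
by apply/facesP; split=> // u /sA/sS.
Qed.

Lemma chain_bd S k c : chain S k.+1 c -> chain S k (bd c).
Proof.
move=> hc B hB; rewrite !ffunE big1 // => v vB; rewrite hc ?mulr0 //.
apply: contraNN hB => /facesP[sA iA cA]; apply/facesP; split.
- by move=> u uB; apply: sA; rewrite inE uB orbT.
- by move=> u w uB wB; apply: iA; rewrite inE ?uB ?wB orbT.
- by move: cA; rewrite cardsU1 vB add1n => -[].
Qed.

Lemma bd_chain0 S c : chain S 0 c -> bd c = 0.
Proof.
move=> hc; apply/ffunP => B; rewrite !ffunE big1 // => v vB.
by rewrite hc ?mulr0 // inE cardsU1 vB andbF.
Qed.

Lemma chain_contr0 S v k c : v \notin S -> chain S k c -> contr v c = 0.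
Proof.
move=> vS hc; apply/ffunP => A; rewrite !ffunE; case: ifP => // vA.
rewrite hc ?mulr0 //; apply/facesP => -[/(_ v)].
by rewrite setU11 (negbTE vS) => /(_ isT).
Qed.

(** * Deletion and link of a vertex *)

Definition link v S := [set u in S | (u != v) && ~~ e v u].

Lemma link_sub v S : link v S \subset S :\ v.
Proof. by apply/subsetP => u; rewrite !inE => /and3P[-> ->]. Qed.

Hypotheses (e_sym : symmetric e) (e_irr : irreflexive e).

Lemma chain_contr v S k c : chain S k.+1 c -> chain (link v S) k (contr v c).
Proof.
move=> hc A hA; rewrite !ffunE; case: ifPn => // vA.
rewrite hc ?mulr0 //; apply: contraNN hA => /facesP[sA iA cA].
apply/facesP; split.
- move=> u uA; rewrite inE sA ?inE ?uA ?orbT //=.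
  rewrite iA ?inE ?eqxx ?uA ?orbT // andbT.
  by apply: contraNneq vA => <-.
- by move=> u w uA wA; apply: iA; rewrite inE ?uA ?wA orbT.
- by move: cA; rewrite cardsU1 vA add1n => -[].
Qed.

Lemma chain_wedge v S k c :
  v \in S -> chain (link v S) k c -> chain S k.+1 (wedge v c).
Proof.
move=> vS hc A hA; rewrite !ffunE; case: ifPn => // vA.
rewrite hc ?mulr0 //; apply: contraNN hA => /facesP[sA iA cA].
have hu u : u \in A -> u != v -> (u \in S) && ~~ e v u.
  by move=> uA uv; move: (sA u); rewrite !inE uA uv => /(_ isT).
apply/facesP; split.
- move=> u uA; case: (eqVneq u v) => [->//|uv].
  by case/andP: (hu u uA uv).
- move=> u w uA wA.
  case: (eqVneq u v) => [->|uv]; last first.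
    case: (eqVneq w v) => [->|wv]; last by apply: iA; rewrite !inE ?uv ?wv.
    by rewrite e_sym; case/andP: (hu u uA uv).
  case: (eqVneq w v) => [->|wv]; first by rewrite e_irr.
  by case/andP: (hu w wA wv).
- by rewrite (cardsD1 v) vA cA.
Qed.

Lemma chain_free_part v S k c :
  chain S k c -> chain (S :\ v) k (c - wedge v (contr v c)).
Proof.
move=> hc A hA.
have -> : (c - wedge v (contr v c)) A = c A - wedge v (contr v c) A by rewrite !ffunE.
rewrite wedge_contr.
case: ifPn => vA; first by rewrite subrr.
rewrite subr0; apply: hc; apply: contraNN hA => /facesP[sA iA cA].
apply/facesP; split=> // u uA; rewrite !inE sA // andbT.
by apply: contraNneq vA => <-.
Qed.

(** Adding the isolated vertex [v] keeps a set independent, so the complex is a cone and [wedge v]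
    fills every cycle. *)
Lemma acyclic_cone v S k :
  v \in S -> {in S, forall u, ~~ e v u} -> acyclic_at S k.
Proof.
move=> vS iso c hc bc0; exists (wedge v c); last by rewrite bd_wedge bc0 raddf0 subr0.
move=> A hA; rewrite !ffunE; case: ifPn => // vA.
rewrite hc ?mulr0 //; apply: contraNN hA => /facesP[sA iA cA].
have hu u : u \in A -> u \in S.
  by case: (eqVneq u v) => [->//|uv] uA; apply: sA; rewrite !inE uv.
apply/facesP; split=> //.
- move=> u w uA wA.
  case: (eqVneq u v) => [->|uv]; first exact/iso/hu.
  case: (eqVneq w v) => [->|wv]; first by rewrite e_sym iso ?hu.
  by apply: iA; rewrite !inE ?uv ?wv.
- by rewrite (cardsD1 v) vA cA.
Qed.

(** With [acyclic_del_inv] and [acyclic_link], this is the exactness of the long sequence of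
    [S :\ v], [S] and the link, on chains. A filling [d1] of [contr v c] in the link moves [c] off
    [v]: the chain [c + bd (wedge v d1)] lives on [S :\ v]. *)
Lemma acyclic_del v S k :
    v \in S -> acyclic_at (S :\ v) k.+1 -> acyclic_at (link v S) k ->
  acyclic_at S k.+1.
Proof.
move=> vS aD aL c hc bc0.
have b1 : bd (contr v c) = 0.
  rewrite bd_contr bc0; apply/ffunP => A; rewrite !ffunE mulr0.
  by rewrite if_same oppr0.
have [d1 hd1 bd1] := aL _ (chain_contr (v := v) hc) b1.
have [|| f hf bf] := aD (c - wedge v (contr v c) + d1).
- apply: chainD; first exact: chain_free_part.
  exact: chain_sub (link_sub v S) hd1.
- by rewrite raddfD raddfB /= bc0 bd_wedge b1 raddf0 subr0 sub0r bd1 addNr.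
exists (f - wedge v d1).
  apply: chainD; first exact: chain_sub (subD1set _ _) hf.
  exact/chainN/chain_wedge.
by rewrite raddfB /= bf bd_wedge bd1 opprB -addrA [d1 + _]addrCA subrr addr0 subrK.
Qed.

(** A filling [d] inside [S] is moved off [v] by replacing its part through [v] with a filling of
    [contr v d] in the link. *)
Lemma acyclic_del_inv v S k :
  acyclic_at S k -> acyclic_at (link v S) k -> acyclic_at (S :\ v) k.
Proof.
move=> aS aL c hc bc0.
have [d hd bd_d] := aS c (chain_sub (subD1set _ _) hc) bc0.
have b1 : bd (contr v d) = 0.
  by rewrite bd_contr bd_d (chain_contr0 _ hc) ?oppr0 // !inE eqxx.
have [f hf bf] := aL _ (chain_contr (v := v) hd) b1.
exists (d - wedge v (contr v d) + f).
  apply: chainD; first exact: chain_free_part.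
  exact: chain_sub (link_sub v S) hf.
by rewrite raddfD raddfB /= bd_d bd_wedge b1 raddf0 subr0 bf subrK.
Qed.

(** Coning a link cycle with [v] and capping it by a filling off [v] gives a cycle of [S];
    contracting a filling of that cycle by [v] fills the original one, up to sign. *)
Lemma acyclic_link v S k :
    v \in S -> acyclic_at (S :\ v) k -> acyclic_at S k.+1 ->
  acyclic_at (link v S) k.
Proof.
move=> vS aD aS c hc bc0.
have [d hd bd_d] := aD c (chain_sub (link_sub v S) hc) bc0.
have [|| f hf bf] := aS (wedge v c - d).
- apply: chainD; first exact: chain_wedge.
  exact/chainN/(chain_sub (subD1set _ _) hd).
- by rewrite raddfB /= bd_d bd_wedge bc0 raddf0 subr0 subrr.
exists (- contr v f); first exact/chainN/chain_contr.
rewrite raddfN /= bd_contr opprK bf; apply/ffunP => A; rewrite !ffunE.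
case: ifPn => vA.
  rewrite hc //; apply/facesP => -[/(_ v vA)].
  by rewrite !inE eqxx andbF.
rewrite setU11 setU1K // sgnU1 // psgnxx mul1r hd ?subr0 ?mulrA ?sgn_sqr ?mul1r //.
apply/facesP => -[/(_ v)].
by rewrite !inE eqxx => /(_ isT).
Qed.

Lemma acyclic_suspension v S k : v \in S ->
    (forall j, acyclic_at (S :\ v) j) ->
  acyclic_at S k.+1 <-> acyclic_at (link v S) k.
Proof.
move=> vS aD; split; first exact: acyclic_link.
exact: acyclic_del.
Qed.

(** The vertex [v] bounds the empty face. This supplies the lowest index, which [acyclic_del] does
    not reach. *)
Lemma acyclic0 v S : v \in S -> acyclic_at S 0.
Proof.
move=> vS c hc _.
have -> : c = bd (wedge v c) by rewrite bd_wedge (bd_chain0 hc) raddf0 subr0.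
exists (wedge v c) => //; apply: chain_wedge => // A hA; apply: hc.
apply: contraNN hA => /facesP[_ iA cA].
by apply/facesP; split=> // u; rewrite (cards0_eq cA) inE.
Qed.

Lemma acyclic_remove v S k : v \in S ->
    (forall j, acyclic_at (link v S) j) ->
  acyclic_at S k <-> acyclic_at (S :\ v) k.
Proof.
move=> vS aL; split=> [aS|]; first exact: acyclic_del_inv.
case: k => [_|k aD]; first exact: acyclic0 vS.
exact: acyclic_del vS aD (aL k).
Qed.

(** Neighbours of [u] in [S] are neighbours of [v], so [u] is isolated in the link of [v], which is
    therefore a cone. *)
Lemma acyclic_fold u v S k :
    u \in S -> v \in S -> u != v -> ~~ e u v ->
    {in S, forall w, e u w -> e v w} ->
  acyclic_at S k <-> acyclic_at (S :\ v) k.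
Proof.
move=> uS vS uv euv dom; apply: acyclic_remove => // j.
apply: (@acyclic_cone u); first by rewrite inE uS uv e_sym.
by move=> w; rewrite inE => /and3P[wS _]; apply: contraNN => /(dom w wS).
Qed.

(** * Comparison with the matrix definition of homology *)

Definition chain_of_row S k (u : 'rV[K]_#|faces e S k|) : cvec :=
  [ffun A : {set T} => \sum_(i | enum_val i == A) u 0 i].

Definition row_of_chain S k c : 'rV[K]_#|faces e S k| :=
  \row_i c (enum_val i).

Lemma chain_of_rowP S k (u : 'rV_#|faces e S k|) : chain S k (chain_of_row u).
Proof.
move=> A hA; rewrite ffunE big1 // => i /eqP iA.
by move: hA; rewrite -iA enum_valP.
Qed.

Lemma chain_of_rowK S k : cancel (@chain_of_row S k) (@row_of_chain S k).
Proof.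
move=> u; apply/rowP => i; rewrite mxE ffunE (bigD1 i) //= big1 ?addr0 //.
by move=> j /andP[/eqP/enum_val_inj->]; rewrite eqxx.
Qed.

Lemma row_of_chain_inj S k c d : chain S k c -> chain S k d ->
  row_of_chain S k c = row_of_chain S k d -> c = d.
Proof.
move=> hc hd /rowP cd; apply/ffunP => A.
have [hA|hA] := boolP (A \in faces e S k); last by rewrite hc ?hd.
by move: (cd (enum_rank_in hA A)); rewrite !mxE enum_rankK_in.
Qed.

Lemma row_of_chain_bd S k c : chain S k.+1 c ->
  row_of_chain S k (bd c) = row_of_chain S k.+1 c *m bdmx K e S k.
Proof.
move=> hc; apply/rowP => j; rewrite !mxE ffunE.
set B := enum_val j.
transitivity (\sum_(A in faces e S k.+1) c A * bdcoef K A B); last first.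
  by rewrite [LHS]big_enum_val; apply: eq_bigr => i _; rewrite !mxE.
rewrite [RHS]big_mkcond /=.
under [RHS]eq_bigr => A _.
  have -> : (if A \in faces e S k.+1 then c A * bdcoef K A B else 0)
    = \sum_(v | (v \in A) && (B == A :\ v)) sgn K v A * c A.
    rewrite -mulr_suml mulrC; case: ifPn => [_|/hc ->]; last by rewrite mulr0.
    by congr (_ * _); apply: eq_bigr => v _; rewrite sgnE.
  over.
(* For fixed [v] outside [B], only [A = v |: B] contributes; for [v] in [B] there is no such [A]. *)
rewrite (exchange_big_dep predT) //= [LHS]big_mkcond /=.
apply: eq_bigr => v _; case: ifPn => [vB|/negPn vB]; last first.
  rewrite big1 // => A /andP[vA /eqP BA].
  by move: vB; rewrite BA !inE eqxx.
rewrite (big_pred1 (v |: B)) => [|A /=].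
  by rewrite sgnU1 // psgnxx mul1r.
apply/andP/eqP => [[vA /eqP ->]|->]; first by rewrite setD1K.
by rewrite setU11 setU1K.
Qed.

Lemma redhom_nzPn S k : reflect (acyclic_at S k) (~~ redhom_nz K e S k).
Proof.
have sub c d : chain S k c -> chain S k.+1 d ->
    row_of_chain S k c = row_of_chain S k.+1 d *m bdmx K e S k -> bd d = c.
  move=> hc hd; rewrite -row_of_chain_bd // => E.
  exact: row_of_chain_inj (chain_bd hd) hc (esym E).
have cyc c : chain S k c -> reflect (bd c = 0) (row_of_chain S k c <= cycles K e S k)%MS.
  (* At index 0 [cycles] is the whole space, in agreement with [bd_chain0]. *)
  case: k {sub} => [|k] hc /=.
    by rewrite submx1 (bd_chain0 hc); constructor.
  apply: (iffP sub_kermxP); rewrite -row_of_chain_bd // => E.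
    apply: (@row_of_chain_inj S k) => //; first exact: chain_bd.
      by move=> A _; rewrite ffunE.
    by rewrite E; apply/rowP => i; rewrite !mxE ffunE.
  by rewrite E; apply/rowP => i; rewrite !mxE ffunE.
rewrite negbK; apply: (iffP idP) => [sCB c hc /(cyc c hc) bc0|aS].
  have /submxP[D E] := submx_trans bc0 sCB.
  exists (chain_of_row D); first exact: chain_of_rowP.
  apply: sub => //; first exact: chain_of_rowP.
  by rewrite chain_of_rowK.
apply/rV_subP => u hu.
have hc := chain_of_rowP u.
have [|d hd E] := aS _ hc; first by apply/(cyc _ hc); rewrite chain_of_rowK.
apply/submxP; exists (row_of_chain S k.+1 d).
by rewrite -row_of_chain_bd // E chain_of_rowK.
Qed.

End Chains.

Arguments acyclic_at K {T} e S k.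

(** * Invariance under induced embeddings *)

Section Embedding.
Variables (K : fieldType) (T T' : finType) (e : rel T) (e' : rel T') (f : T -> T').
Hypotheses (f_inj : injective f) (ef : forall u v, e' (f u) (f v) = e u v).
Implicit Types (A B S : {set T}) (D : {set T'}).

(* The sign of the permutation that sorts [f @: A]: a product over inversions. *)
Definition invsgn A : K :=
  \prod_(u in A) \prod_(v in A)
    if (enum_rank u < enum_rank v)%N && (enum_rank (f v) < enum_rank (f u))%N
    then -1 else 1.

Lemma invsgn_sqr A : invsgn A * invsgn A = 1.
Proof.
rewrite /invsgn -big_split big1 //= => u _.
by rewrite -big_split big1 //= => v _; case: ifP; rewrite ?mulrNN mul1r.
Qed.

(** The new inversions are those between [v] and some [u] in [A]; for each [u] their factor is the
    product of [psgn u v] and [psgn (f u) (f v)]. *)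
Lemma invsgnU1 v A : v \notin A ->
  sgn K v A * invsgn (v |: A) = invsgn A * sgn K (f v) (f @: A).
Proof.
move=> vA; rewrite /invsgn big_setU1 //= big_setU1 //= ltnn mul1r.
under [X in _ * (_ * X)]eq_bigr do rewrite big_setU1 //=.
rewrite [X in _ * (_ * X)]big_split /= !mulrA [RHS]mulrC; congr (_ * _).
rewrite /sgn big_imset /=; last by move=> u w _ _; apply: f_inj.
rewrite -!big_split; apply: eq_bigr => u uA /=.
have uv : u != v by apply: contraNneq vA => <-.
rewrite /psgn (enum_rank_ltgt uv) (enum_rank_ltgt (u := f u) (v := f v)) ?(inj_eq f_inj) //.
by do 2!case: ltnP => _; rewrite /= ?(mulr1, mulrNN, mul1r).
Qed.

(** As [f] need not preserve the vertex order, the factor [invsgn] is what makes transport commute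
    with [bd]. *)
Definition pull (c : {ffun {set T'} -> K}) : {ffun {set T} -> K} :=
  [ffun A : {set T} => invsgn A * c (f @: A)].

Definition push (c : {ffun {set T} -> K}) : {ffun {set T'} -> K} :=
  [ffun D : {set T'} =>
    if f @: (f @^-1: D) == D then invsgn (f @^-1: D) * c (f @^-1: D) else 0].

Lemma imsetK_pre A : f @^-1: (f @: A) = A.
Proof. by apply/setP => u; rewrite inE mem_imset. Qed.

Lemma faces_imset S k A : (f @: A \in faces e' (f @: S) k) = (A \in faces e S k).
Proof.
apply/facesP/facesP => -[sA iA cA]; split.
- by move=> u uA; rewrite -(mem_imset _ _ f_inj) sA // imset_f.
- by move=> u v uA vA; rewrite -ef iA // imset_f.
- by rewrite -cA card_imset.
- by move=> _ /imsetP[u uA ->]; rewrite imset_f // sA.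
- by move=> _ _ /imsetP[u uA ->] /imsetP[v vA ->]; rewrite ef iA.
- by rewrite card_imset.
Qed.

Lemma face_imset S k D : D \in faces e' (f @: S) k -> f @: (f @^-1: D) = D.
Proof.
move=> /facesP[sA _ _]; apply/setP => a; apply/imsetP/idP => [[u + ->]|aA].
  by rewrite inE.
by have /imsetP[u _ E] := sA a aA; exists u; rewrite // inE -E.
Qed.

Lemma pushK : cancel push pull.
Proof.
move=> c; apply/ffunP => A.
by rewrite !ffunE imsetK_pre eqxx mulrA invsgn_sqr mul1r.
Qed.

Lemma chain_pull S k c : chain e' (f @: S) k c -> chain e S k (pull c).
Proof. by move=> hc A hA; rewrite ffunE hc ?mulr0 // faces_imset. Qed.

Lemma chain_push S k c : chain e S k c -> chain e' (f @: S) k (push c).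
Proof.
move=> hc D hA; rewrite ffunE; case: eqP => // E.
by rewrite hc ?mulr0 // -faces_imset E.
Qed.

Lemma pull_inj S k c d : chain e' (f @: S) k c -> chain e' (f @: S) k d ->
  pull c = pull d -> c = d.
Proof.
move=> hc hd /ffunP cd; apply/ffunP => D.
have [hA|hA] := boolP (D \in faces e' (f @: S) k); last by rewrite hc ?hd.
have := congr1 ( *%R (invsgn (f @^-1: D))) (cd (f @^-1: D)).
by rewrite !ffunE (face_imset hA) !mulrA invsgn_sqr !mul1r.
Qed.

Lemma bd_pull S k c : chain e' (f @: S) k c -> bd (pull c) = pull (bd c).
Proof.
move=> hc; apply/ffunP => A; rewrite !ffunE mulr_sumr.
(* Vertices outside the image of [f] contribute nothing, because [c] is supported on subsets of
   [f @: S]. *)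
rewrite [RHS](bigID [in f @: ~: A]) /= [X in _ + X]big1 ?addr0; last first.
  move=> a /andP[aA aS]; rewrite hc ?mulr0 //.
  apply/facesP => -[/(_ a)]; rewrite setU11 => /(_ isT) /imsetP[u _ E].
  by case/imsetP: aS; exists u; rewrite // inE -(mem_imset _ _ f_inj) -E.
rewrite (eq_bigl [in f @: ~: A]) => [|a /=]; last first.
  by apply: andb_idl => /imsetP[u uA ->]; rewrite mem_imset // -in_setC.
rewrite big_imset /=; last by move=> u w _ _; apply: f_inj.
apply: eq_big => [v|v vA]; first by rewrite inE.
by rewrite !ffunE imsetU1 !mulrA invsgnU1.
Qed.

(** Boundary identities for [push] are checked after applying [pull], which is injective on chains
    of [f @: S] and inverts [push]. *)
Lemma acyclic_imset S k : acyclic_at K e' (f @: S) k <-> acyclic_at K e S k.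
Proof.
have pull0 : pull 0 = 0 by apply/ffunP => A; rewrite !ffunE mulr0.
have zero j : chain e' (f @: S) j (0 : {ffun {set T'} -> K}) by move=> D _; rewrite ffunE.
split=> aS c hc bc0.
- have hpc := chain_push hc.
  have [|d hd bd_d] := aS (push c) hpc.
    case: k aS hc hpc => [_ _ /bd_chain0//|k _ hc hpc].
    apply: (pull_inj (chain_bd hpc) (zero k)).
    by rewrite -(bd_pull hpc) pushK pull0.
  exists (pull d); first exact: chain_pull.
  by rewrite (bd_pull hd) bd_d pushK.
- have [|d hd bd_d] := aS (pull c) (chain_pull hc).
    by rewrite (bd_pull hc) bc0.
  have hpd := chain_push hd.
  exists (push d) => //; apply: (pull_inj (chain_bd hpd) hc).
  by rewrite -(bd_pull hpd) pushK.
Qed.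

End Embedding.

(** * Regularity *)

Section Regularity.
Variables (K : fieldType) (T : finType) (e : rel T).

Lemma acyclic_gt_reg S k : (reg K e < k)%N -> acyclic_at K e S k.
Proof.
move=> rk; apply/redhom_nzPn/negP => nz.
have [kT|Tk] := ltnP k #|T|.+2.
  have : (k <= reg K e)%N.
    apply: (@leq_bigmax_cond _ _ (fun j : 'I_#|T|.+2 => nat_of_ord j) (Ordinal kT)).
    by apply/existsP; exists S.
  by rewrite leqNgt rk.
(* Beyond the range of the maximum no set has [k] elements, so the only chain is 0. *)
apply: (negP _ nz); apply/redhom_nzPn => c hc _.
have c0 : c = 0.
  apply/ffunP => A; rewrite ffunE; apply: hc.
  apply/facesP => -[_ _ cA].
  by have := max_card A; rewrite cA leqNgt (leq_trans _ Tk).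
exists 0; first by move=> A _; rewrite ffunE.
by rewrite c0 raddf0.
Qed.

(** The empty face is a cycle, and without vertices nothing bounds it. Hence the maximum defining
    [reg] is over a nonempty set and is attained. *)
Lemma not_acyclic_set0 : ~ acyclic_at K e set0 0.
Proof.
pose c : {ffun {set T} -> K} := [ffun A : {set T} => (A == set0)%:R].
have hc : chain e set0 0 c.
  move=> A; rewrite ffunE; case: eqP => // ->; case/facesP; split.
  - by move=> u; rewrite inE.
  - by move=> u v; rewrite inE.
  - by rewrite cards0.
move=> /(_ c hc (bd_chain0 hc))[d hd] /ffunP/(_ set0); rewrite !ffunE eqxx big1.
  by move/eqP; rewrite eq_sym oner_eq0.
move=> v _; rewrite hd ?mulr0 //; apply/facesP => -[/(_ v)].
by rewrite setU11 inE => /(_ isT).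
Qed.

Lemma reg_attained : exists S, ~ acyclic_at K e S (reg K e).
Proof.
pose P : pred 'I_#|T|.+2 := [pred j | [exists S : {set T}, redhom_nz K e S (nat_of_ord j)]].
have P0 : (0 < #|P|)%N.
  apply/card_gt0P; exists ord0; rewrite inE; apply/existsP; exists set0.
  by apply: contraT => /redhom_nzPn/not_acyclic_set0.
have [j /existsP[S nz] rj] := eq_bigmax_cond (fun j : 'I_#|T|.+2 => nat_of_ord j) P0.
have -> : reg K e = j by rewrite -rj; apply: eq_bigl.
by exists S => aS; have /negP := introT (redhom_nzPn K e S j) aS.
Qed.

Lemma reg_eq r :
    (forall S k, (r < k)%N -> acyclic_at K e S k) ->
    (exists S, ~ acyclic_at K e S r) ->
  reg K e = r.
Proof.
move=> upper [S naS]; apply/eqP; rewrite eqn_leq; apply/andP; split; rewrite leqNgt.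
  by apply/negP => rr; have [S' []] := reg_attained; apply: upper.
by apply/negP => /(acyclic_gt_reg (S := S)).
Qed.

End Regularity.

(** * The Lozin transform *)

Section Ambient.
Variables (K : fieldType) (T : finType) (e : rel T).
Hypotheses (e_sym : symmetric e) (e_irr : irreflexive e).
Variables (x : T) (Y Z : {set T}).
Hypotheses (nbrs : Y :|: Z = [set v | e x v]).

Local Notation W := (T + 'I_4)%type.

(* [G] and its Lozin transform side by side: the induced subgraph on [T] is [G],
   the one avoiding [inl x] is the Lozin transform.  The extra edge joining
   [inl x] to [a] makes [inl x] dominate [y]. *)
Definition ambient : rel W := fun p q =>
  let att u (i : 'I_4) := [|| (val i == 0%N) && (u \in Y),
    (val i == 1%N) && (u == x) | (val i == 3%N) && (u \in Z)] in
  match p, q with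
  | inl u, inl v => e u v
  | inl u, inr i => att u i
  | inr i, inl u => att u i
  | inr i, inr j => (val i == (val j).+1) || (val j == (val i).+1)
  end.

Definition vy : W := inr (@Ordinal 4 0 isT).
Definition va : W := inr (@Ordinal 4 1 isT).
Definition vb : W := inr (@Ordinal 4 2 isT).
Definition vz : W := inr (@Ordinal 4 3 isT).

(** The four flags record the presence of [y], [a], [b], [z]; links and deletions then compute to
    sets of the same form. *)
Definition vset (D : {set T}) (b0 b1 b2 b3 : bool) : {set W} :=
  [set p : W | match p with
    | inl u => u \in D
    | inr i => nth false [:: b0; b1; b2; b3] i
    end].

Implicit Types (D : {set T}) (k : nat).

Lemma ambient_sym : symmetric ambient.
Proof. by case=> [u|i] [v|j] //=; rewrite orbC. Qed.

Lemma ambient_irr : irreflexive ambient.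
Proof. by case=> [u|[[|[|[|[|i]]]] hi]] //=; rewrite e_irr. Qed.

Local Notation acyc := (acyclic_at K ambient).

Lemma nbrsE v : e x v = (v \in Y) || (v \in Z).
Proof. by move/setP/(_ v): nbrs; rewrite !inE. Qed.

Lemma nbrs_x : (x \in Y = false) * (x \in Z = false).
Proof. by have := nbrsE x; rewrite e_irr; case: (x \in Y); case: (x \in Z). Qed.

Ltac vtx_cases := case=> [u|[[|[|[|[|?]]]] ?]]; rewrite ?inE //=.

(** * Links and deletions in the ambient graph *)

Lemma link_y D b0 b1 b2 b3 :
  link ambient vy (vset D b0 b1 b2 b3) = vset (D :\: Y) false false b2 b3.
Proof. by apply/setP; vtx_cases; rewrite ?andbF ?andbT ?orbF // andbC. Qed.

Lemma link_a D b0 b1 b2 b3 :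
  link ambient va (vset D b0 b1 b2 b3) = vset (D :\ x) false false false b3.
Proof. by apply/setP; vtx_cases; rewrite ?andbF ?andbT ?orbF // andbC. Qed.

Lemma link_b D b0 b1 b2 b3 :
  link ambient vb (vset D b0 b1 b2 b3) = vset D b0 false false false.
Proof. by apply/setP; vtx_cases; rewrite ?andbF ?andbT ?orbF // andbC. Qed.

Lemma link_z D b0 b1 b2 b3 :
  link ambient vz (vset D b0 b1 b2 b3) = vset (D :\: Z) b0 b1 false false.
Proof. by apply/setP; vtx_cases; rewrite ?andbF ?andbT ?orbF // andbC. Qed.

Lemma del_x D b0 b1 b2 b3 :
  vset D b0 b1 b2 b3 :\ inl x = vset (D :\ x) b0 b1 b2 b3.
Proof. by apply/setP; vtx_cases. Qed.

Lemma del_y D b0 b1 b2 b3 : vset D b0 b1 b2 b3 :\ vy = vset D false b1 b2 b3.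
Proof. by apply/setP; vtx_cases. Qed.

Lemma del_a D b0 b1 b2 b3 : vset D b0 b1 b2 b3 :\ va = vset D b0 false b2 b3.
Proof. by apply/setP; vtx_cases. Qed.

Lemma del_b D b0 b1 b2 b3 : vset D b0 b1 b2 b3 :\ vb = vset D b0 b1 false b3.
Proof. by apply/setP; vtx_cases. Qed.

Lemma del_z D b0 b1 b2 b3 : vset D b0 b1 b2 b3 :\ vz = vset D b0 b1 b2 false.
Proof. by apply/setP; vtx_cases. Qed.

Lemma acyclic_a D b3 k : x \notin D -> acyc (vset D false true false b3) k.
Proof.
move=> xD; apply: (acyclic_cone ambient_sym (v := va)); first by rewrite inE.
by vtx_cases; rewrite ?orbF //; apply: contraTneq => ->.
Qed.

Lemma acyclic_b D b0 k : acyc (vset D b0 false true false) k.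
Proof.
by apply: (acyclic_cone ambient_sym (v := vb)); [rewrite inE | vtx_cases].
Qed.

Let dominated := acyclic_fold K ambient_sym ambient_irr.

(** On [D], which avoids [Z], the nonadjacent vertices [x] and [y] have the same neighbours; each
    dominates the other, so either can be deleted from the subgraph containing both. *)
Lemma twin_y D k : x \notin D -> [disjoint D & Z] ->
  acyc (vset D true false false false) k <->
  acyc (vset (x |: D) false false false false) k.
Proof.
move=> xD /pred0P DZ.
have := dominated (u := vy) (v := inl x) (S := vset (x |: D) true false false false) k.
rewrite del_x setU1K // => <-; first 1 last.
- by rewrite inE.
- by rewrite !inE eqxx.
- by [].
- by rewrite /= nbrs_x.
- by vtx_cases; rewrite nbrsE orbF => _ ->.
have := dominated (u := inl x) (v := vy) (S := vset (x |: D) true false false false) k.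
rewrite del_y => -> //.
- by rewrite !inE eqxx.
- by rewrite inE.
- by rewrite /= nbrs_x.
- vtx_cases; rewrite ?nbrs_x // nbrsE !orbF => /orP[/eqP->|uD]; rewrite ?nbrs_x //.
  by have := DZ u; rewrite /= uD => /= ->; rewrite orbF.
Qed.

Lemma twin_z D k : x \notin D -> [disjoint D & Y] ->
  acyc (vset D false false false true) k <->
  acyc (vset (x |: D) false false false false) k.
Proof.
move=> xD /pred0P DY.
have := dominated (u := vz) (v := inl x) (S := vset (x |: D) false false false true) k.
rewrite del_x setU1K // => <-; first 1 last.
- by rewrite inE.
- by rewrite !inE eqxx.
- by [].
- by rewrite /= nbrs_x.
- by vtx_cases; rewrite nbrsE => _ ->; rewrite orbT.
have := dominated (u := inl x) (v := vz) (S := vset (x |: D) false false false true) k.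
rewrite del_z => -> //.
- by rewrite !inE eqxx.
- by rewrite inE.
- by rewrite /= nbrs_x.
- vtx_cases; rewrite ?nbrs_x // nbrsE => /orP[/eqP->|uD]; rewrite ?nbrs_x //.
  by have := DY u; rewrite /= uD => /= ->.
Qed.

Lemma acyclic_lozin D k : x \notin D ->
  acyc (vset D true true true true) k.+1 <->
  acyc (vset (x |: D) false false false false) k.
Proof.
move=> xD.
(* Adding [x] is harmless: the neighbours of [y], namely [Y] and [a], are all neighbours of [x]. *)
have := dominated (u := vy) (v := inl x) (S := vset (x |: D) true true true true) k.+1.
rewrite del_x setU1K // => <-; first 1 last.
- by rewrite inE.
- by rewrite !inE eqxx.
- by [].
- by rewrite /= nbrs_x.
- by vtx_cases; rewrite ?eqxx // nbrsE orbF => _ ->.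
(* Deleting [y]: in its link [Y] and [a] are gone, so the remaining neighbours of [x] are neighbours
   of [z]; once [z] is deleted, [b] is isolated. *)
have -> : acyc (vset (x |: D) true true true true) k.+1 <->
    acyc (vset (x |: D) false true true true) k.+1.
  rewrite -(del_y _ true); apply: (acyclic_remove ambient_sym ambient_irr).
    by rewrite inE.
  move=> j; rewrite link_y.
  rewrite (dominated (u := inl x) (v := vz)) ?del_z; first exact: acyclic_b.
  - by rewrite !inE eqxx nbrs_x.
  - by rewrite inE.
  - by [].
  - by rewrite /= nbrs_x.
  - by vtx_cases; rewrite ?nbrs_x // nbrsE => /andP[/negbTE -> _].
(* Without [b], the neighbours of [z] lie in [Z], so [x] can be deleted, which isolates [a]. *)
have aD j : acyc (vset (x |: D) false true true true :\ vb) j.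
  rewrite del_b (dominated (u := vz) (v := inl x)) ?del_x ?setU1K //.
  - exact: acyclic_a.
  - by rewrite inE.
  - by rewrite !inE eqxx.
  - by rewrite /= nbrs_x.
  - by vtx_cases; rewrite ?eqxx // nbrsE => _ ->; rewrite orbT.
have vbS : vb \in vset (x |: D) false true true true by rewrite inE.
by rewrite (acyclic_suspension ambient_sym ambient_irr k vbS aD) link_b.
Qed.

(** The edge from [a] to [b] is a separate component, and joining with its two-point independence
    complex is suspension. *)
Lemma acyclic_edge D k : x \notin D ->
  acyc (vset D false true true false) k.+1 <->
  acyc (vset D false false false false) k.
Proof.
move=> xD; have vbS : vb \in vset D false true true false by rewrite inE.
have aD j : acyc (vset D false true true false :\ vb) j.
  by rewrite del_b; exact: acyclic_a.
by rewrite (acyclic_suspension ambient_sym ambient_irr k vbS aD) link_b.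
Qed.

(** Apart from the full path and the cases with an isolated vertex, [acyclic_del] removes one vertex
    at a time; passing to a link lowers the index by one, which the successor in the conclusion
    absorbs. *)
Lemma acyclic_upper r :
    (forall D k, (r < k)%N -> acyc (vset D false false false false) k) ->
  forall D b0 b1 b2 b3 k, x \notin D -> (r < k)%N ->
    acyc (vset D b0 b1 b2 b3) k.+1.
Proof.
move=> aG D b0 b1 b2 b3 k xD rk.
have del v := acyclic_del (K := K) ambient_sym ambient_irr (v := v).
(* The link of [y] avoids [Y], so there [z] plays the role of [x]; symmetrically for the link of [z]
   in [aZ]. *)
have aY b : acyc (vset (D :\: Y) false false false b) k.
  case: b; last exact: aG.
  apply/twin_z; last exact: aG; first by rewrite inE (negbTE xD) andbF.
  by rewrite disjoint_sym disjoints_subset setCD subsetUr.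
have aZ b : acyc (vset (D :\: Z) b false false false) k.
  case: b; last exact: aG.
  apply/twin_y; last exact: aG; first by rewrite inE (negbTE xD) andbF.
  by rewrite disjoint_sym disjoints_subset setCD subsetUr.
have aDz b : acyc (vset D false false false b) k.+1.
  case: b; last exact/aG/leqW.
  apply: (del vz); rewrite ?inE // ?del_z ?link_z //.
  exact/aG/leqW.
(* Cases by the presence of [a] and [b]. The vertex removed is chosen so that the deletion isolates
   [a] or [b], except in the last case, where neither is present. *)
case: b1; case: b2.
- case: b0; last first.
    by apply: (del vb); rewrite ?inE // ?del_b ?link_b; [exact: acyclic_a | exact: aG].
  case: b3; first by apply/acyclic_lozin => //; exact: aG.
  by apply: (del va); rewrite ?inE // ?del_a ?link_a; [exact: acyclic_b | exact: aG].
- case: b0; last exact: acyclic_a.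
  by apply: (del vy); rewrite ?inE // ?del_y ?link_y //; exact: acyclic_a.
- case: b3; last exact: acyclic_b.
  by apply: (del vz); rewrite ?inE // ?del_z ?link_z //; exact: acyclic_b.
- case: b0 => //.
  by apply: (del vy); rewrite ?inE // ?del_y ?link_y.
Qed.

Lemma acyclic_ambient_G S k :
  acyc (vset S false false false false) k <-> acyclic_at K e S k.
Proof.
have -> : vset S false false false false = inl @: S.
  apply/setP; vtx_cases; first by rewrite mem_imset //; apply: inl_inj.
  1-4: by apply/esym/imsetP => -[].
by apply: acyclic_imset => // u v [].
Qed.

Definition to_ambient (p : lozin_vtx x) : W :=
  match p with inl u => inl (val u) | inr i => inr i end.

(** The image of [to_ambient] avoids [inl x], so the extra edge between [x] and [a] is never
    seen. *)
Lemma acyclic_ambient_lozin (S : {set lozin_vtx x}) k :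
  acyc (to_ambient @: S) k <-> acyclic_at K (lozin_rel e x Y Z) S k.
Proof.
apply: acyclic_imset.
  by case=> [u|i] [v|j] //= []; [move/val_inj-> | move->].
by case=> [[u ux]|i] [[v vx]|j] //=; rewrite ?(negbTE ux) ?(negbTE vx) andbF.
Qed.

End Ambient.

(** * Regularity of the Lozin transform *)

Theorem theorem1p2 (K : fieldType) (T : finType) (e : rel T)
  (e_sym : symmetric e) (e_irr : irreflexive e)
  (x : T) (Y Z : {set T})
  (hdisj : [disjoint Y & Z]) (hpart : Y :|: Z = [set v | e x v]) :
  reg K (lozin_rel e x Y Z) = (reg K e).+1.
Proof.
have vsetE (S : {set lozin_vtx x}) : exists (D : {set T}) (b0 b1 b2 b3 : bool),
    x \notin D /\ @to_ambient _ x @: S = vset D b0 b1 b2 b3.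
  pose f := @to_ambient _ x; pose b i := inr i \in f @: S.
  exists [set u | inl u \in f @: S].
  exists (b (@Ordinal 4 0 isT)), (b (@Ordinal 4 1 isT)).
  exists (b (@Ordinal 4 2 isT)), (b (@Ordinal 4 3 isT)); split.
    by rewrite inE; apply/imsetP => -[[[u /= ux]|//] _ [E]]; rewrite E eqxx in ux.
  apply/setP; case=> [u|[[|[|[|[|?]]]] ilt]]; rewrite !inE //=;
    by rewrite (bool_irrelevance ilt isT).
(* An index above [(reg K e).+1] is a successor, the form in which [acyclic_upper] applies. *)
apply: reg_eq => [S [//|k]|].
  rewrite ltnS => rk; apply/acyclic_ambient_lozin.
  have [D [b0 [b1 [b2 [b3 [xD ->]]]]]] := vsetE S.
  apply: (@acyclic_upper K T e e_sym e_irr x Y Z hpart (reg K e)) => // D' j rj.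
  exact/acyclic_ambient_G/acyclic_gt_reg.
have [S naS] := reg_attained K e.
have preK (D : {set T}) b0 b1 b2 b3 : x \notin D ->
    @to_ambient _ x @: (@to_ambient _ x @^-1: vset D b0 b1 b2 b3) = vset D b0 b1 b2 b3.
  move=> xD; apply/setP => p; apply/imsetP/idP => [[q + ->]|]; first by rewrite inE.
  case: p => [u|i] pV; last by exists (inr i) => //; rewrite inE.
  have uD : u \in D by rewrite inE in pV.
  have ux : u != x by apply: contraNneq xD => <-.
  by exists (inl (exist _ u ux)) => //; rewrite inE.
(* For the lower bound, a set [S] attaining [reg K e] is lifted with a shift by one: [x] is replaced
   by the whole path if it lies in [S], and otherwise the edge from [a] to [b] is added. *)
have [xS|xS] := boolP (x \in S).
- have xD : x \notin S :\ x by rewrite !inE eqxx.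
  exists (@to_ambient _ x @^-1: vset (S :\ x) true true true true).
  move=> /acyclic_ambient_lozin; rewrite preK // => /(acyclic_lozin K e_sym e_irr hpart).
  by rewrite setD1K // => /(_ xD)/acyclic_ambient_G.
- exists (@to_ambient _ x @^-1: vset S false true true false).
  move=> /acyclic_ambient_lozin; rewrite preK //.
  by move=> /(acyclic_edge K e_sym e_irr Y Z _ xS)/acyclic_ambient_G.
Qed.
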